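(* Assume that there exists $\theta>0$ satisfying $\psi(\theta)<\infty$. If the branching random walk is critical, i.e. $\psi(0)=0$, and satisfies $\mathbb E(Z_1(\mathbb R)^2)<\infty$, then $\mathbb P(D^\theta_\infty(\mathbb R)=\infty)=1$.
   Context: Branching random walk. $\mathbb N=\{1,2,\dots\}$, $\mathbb T=\bigcup_{n\ge0}\mathbb N^n$ with $\mathbb N^0=\{\varnothing\}$; for $u=(u^{(1)},\dots,u^{(n)})\in\mathbb N^n$, $|u|=n$ and $u_k=(u^{(1)},\dots,u^{(k)})$ for $k\le n$ (with $u_0=\varnothing$). Let $\mathcal L$ be a point process on $\mathbb R$ (the reproduction law). Let $(z^{(u)}_k)_{k\ge1}$, $u\in\mathbb T$, be i.i.d. random non-increasing sequences with values in $\mathbb R\cup\{-\infty\}$ such that $\sum_{k\ge1}\delta_{z^{(u)}_k}$ is distributed as $\mathcal L$ (with $\delta_{-\infty}:=0$). The branching random walk is $V(\varnothing)=0$, $V(u)=\sum_{i=1}^{|u|}z^{(u_{i-1})}_{u^{(i)}}$ (with $-\infty+x=-\infty$). Vertices with $V(u)=-\infty$ are dead; all sums over $|u|=n$ are over living vertices ($V(u)>-\infty$) only. $Z_n=\sum_{|u|=n}\delta_{V(u)}$, and it is always assumed that $\mathbb P(Z_1(\mathbb R)=0)<1$. $\psi(\theta)=\log\mathbb E\big(\sum_{|u|=1}e^{\theta V(u)}\big)$, so $\psi(0)=\log\mathbb E(Z_1(\mathbb R))$. Auxiliary point process (for $\theta>0$ with $\psi(\theta)<\infty$). Let $((\hat\ell_i)_{i\ge1},\xi)$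 be a random pair, $(\hat\ell_i)$ a non-increasing sequence in $\mathbb R\cup\{-\infty\}$ and $\xi\in\mathbb N$, with law given by $\mathbb E f((\hat\ell_i)_{i\ge1},\xi)=\mathbb E\big(\sum_{k\ge1}e^{\theta V(k)-\psi(\theta)}f((V(i))_{i\ge1},k)\big)$ for all non-negative measurable $f$, where $V(i)$, $i\in\mathbb N$, are the positions of the children of the root ($e^{-\infty}=0$). Let $((b_k(i))_{i\ge1},w^{(k)})_{k\ge1}$ be i.i.d. copies of $((\hat\ell_i)_{i\ge1},\xi)$, and, independently, let $(V^{(i,k)}(u):u\in\mathbb T)$, $i,k\ge1$, be i.i.d. copies of $(V(u):u\in\mathbb T)$. Put $S_n=\sum_{k=1}^nb_k(w^{(k)})$ and $$D^\theta_\infty=\delta_0+\sum_{k=1}^{\infty}\ \sum_{i\ne w^{(k)}}\ \sum_{|u|=k-1}\delta_{b_k(i)+V^{(i,k)}(u)-S_k}$$ (terms located at $-\infty$ are discarded).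
   Formalization: The formal theorem also assumes P(Z_1(R)=1)<1; without it the claim is false: if every particle has exactly one child a.s., all hypotheses can hold (e.g. displacement 0), yet D^θ_∞=δ_0 a.s. *)

(* Defs.v *)
From HB Require Import structures.
From mathcomp Require Import all_boot all_order all_algebra.
From mathcomp Require Import all_classical all_reals all_analysis measurable_realfun.

Set Implicit Arguments.
Unset Strict Implicit.
Unset Printing Implicit Defensive.

Import Order.TTheory GRing.Theory Num.Theory.

Local Open Scope classical_set_scope.
Local Open Scope ring_scope.
Local Open Scope ereal_scope.

(* Ulam-Harris words. Letters are numbered from 0, so the root is [::], the
   children of u are the words rcons u k with k : nat, and u_k is take k u. *)
Definition word := seq nat.

Definition cylinders (I : Type) (R : realType) : set (set (I -> \bar R)) :=
  \bigcup_(i in [set: I])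
    preimage_set_system [set: I -> \bar R] (fun f => f i)
      (measurable : set (set (\bar R))).

(* Sequences and word-indexed families with the product sigma-algebra; the value
   -oo marks a dead vertex. *)
Definition eseq (R : realType) := g_sigma_algebraType (@cylinders nat R).
Definition efield (R : realType) := g_sigma_algebraType (@cylinders word R).

(* delta_x, with delta_(-oo) = 0; the value +oo is discarded as well. *)
Definition edirac (R : realType) (x : \bar R) (A : set R) : \bar R :=
  if x is r%:E then \d_r A else 0.

Definition mutually_independent d (T : measurableType d) (R : realType)
    (P : probability T R) (I : choiceType) (F : I -> set (set T)) :=
  forall (J : seq I) (A : I -> set T), uniq J ->
    (forall i, i \in J -> F i (A i)) ->
  P (\bigcap_(i in [set` J]) A i) = \prod_(i <- J) P (A i).

Section branching_random_walk.
Context d (T : measurableType d) (R : realType) (P : probability T R).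

Definition iid_reproduction (z : word -> {RV P >-> eseq R}) :=
  [/\ forall u t, nonincreasing_seq (z u t : nat -> \bar R),
      forall u t k, z u t k < +oo,
      mutually_independent P (fun u => g_sigma_algebra_preimage (z u)) &
      forall u v (A : set (eseq R)), measurable A ->
        distribution P (z u) A = distribution P (z v) A].

Definition brw (z : word -> {RV P >-> eseq R}) (t : T) : efield R :=
  fun u => \sum_(i < size u) z (take i u) t (nth 0%N u i).

Definition generation (V : T -> efield R) (n : nat) (t : T) (A : set R) :=
  \esum_(u in [set u : word | size u = n]) edirac (V t u) A.

(* The restriction to living vertices matters at theta = 0, where
   0 * -oo = 0 and expeR 0 = 1. *)
Definition psi (V : T -> efield R) (theta : R) : \bar R :=
  lne (\int[P]_t \esum_(u in [set u : word | size u = 1%N /\ -oo < V t u])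
         expeR (theta%:E * V t u)).

End branching_random_walk.

Section auxiliary_point_process.
Context d (T : measurableType d) (R : realType) (P : probability T R).
Context d' (T' : measurableType d') (P' : probability T' R).

(* X has the law of the size-biased pair (children of the root, marked child)
   of the branching random walk V on T. *)
Definition size_biased (V : T -> efield R) (theta : R)
    (X : {RV P' >-> (eseq R * nat)%type}) :=
  forall f : eseq R * nat -> \bar R,
    measurable_fun [set: eseq R * nat] f -> (forall x, 0 <= f x) ->
  \int[P']_t f (X t) =
  \int[P]_t \sum_(k <oo) (expeR (theta%:E * V t [:: k] - psi P V theta) *
                          f ((fun i => V t [:: i]) : eseq R, k)).

(* Mutual independence of all the pairs X k and all the fields W i k. *)
Definition spine_independent (X : nat -> {RV P' >-> (eseq R * nat)%type})
    (W : nat -> nat -> {RV P' >-> efield R}) :=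
  mutually_independent P' (fun j : nat + nat * nat =>
    match j with
    | inl k => g_sigma_algebra_preimage (X k)
    | inr (i, k) => g_sigma_algebra_preimage (W i k)
    end).

Definition spine_walk (X : nat -> {RV P' >-> (eseq R * nat)%type})
    (n : nat) (t : T') : \bar R :=
  \sum_(k < n) (X k t).1 (X k t).2.

(* X k stands for the pair (b_(k+1), w^(k+1)), so that the subtrees attached to
   its unmarked points have depth k and are recentered by S_(k+1). *)
Definition Dinfty (X : nat -> {RV P' >-> (eseq R * nat)%type})
    (W : nat -> nat -> {RV P' >-> efield R}) (t : T') (A : set R) : \bar R :=
  \d_(0%R : R) A +
  \sum_(k <oo) \sum_(i <oo | i != (X k t).2)
    \esum_(u in [set u : word | size u = k])
      edirac ((X k t).1 i + W i k t u - spine_walk X k.+1 t) A.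

End auxiliary_point_process.

(* Main.v *)
(* At each spine step k, with probability p > 0 independent of k, the marked
   point is the first one and a second point is alive; since the law is critical
   with finite variance, the subtree W 1 k of that second point reaches
   generation k with probability at least of order 1/k (Kolmogorov's estimate).
   These events are independent and their probabilities have a divergent sum, so
   by the second Borel-Cantelli lemma infinitely many of them occur, and each
   adds at least one atom to D.

   Kolmogorov's lower bound is the second moment method: E Z_n = 1 and
   E Z_(n+1)^2 <= E Z_n^2 + E Z_1^2 (separate the pairs of distinct parents from
   the pairs with a common one), so that P(Z_n > 0) >= (E Z_n)^2 / E Z_n^2
   >= 1 / (1 + n E Z_1^2). *)

Require Import Defs.
From mathcomp Require Import all_boot all_order all_algebra.
From mathcomp Require Import all_classical all_reals all_analysis measurable_realfun.
From mathcomp Require Import ring lra.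

Set Implicit Arguments.
Unset Strict Implicit.
Unset Printing Implicit Defensive.

Import Order.TTheory GRing.Theory Num.Theory.

Local Open Scope classical_set_scope.
Local Open Scope ring_scope.
Local Open Scope ereal_scope.

(** * Sums over countable types *)

(** Enumerating [I] by pickling codes turns the sum into a series, where measurability and monotone
    convergence work termwise; a number that codes no element contributes 0. *)
Lemma esum_nneseries (R : realType) (I : countType) (D : set I)
    (f : I -> \bar R) : (forall i, D i -> 0 <= f i) ->
  \esum_(i in D) f i =
  \sum_(n <oo) oapp (fun i => if i \in D then f i else 0) 0 (pickle_inv n).
Proof.
move=> f0; set g := fun i => if i \in D then f i else 0.
have g0 i : 0 <= g i by rewrite /g; case: ifPn => // /set_mem /f0.
have h0 n : 0 <= oapp g 0 (pickle_inv n) by case: pickle_inv => //= i.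
rewrite nneseries_esumT// esum_mkcond.
rewrite (esumID (range (@pickle I)) setT)//= !setTI [X in _ = _ + X]esum1; last first.
  move=> n nI; case: (@pickle_inv I n) (@pickle_invK I n) => //= i iE.
  by case: nI; exists i.
rewrite adde0 esum_image; last by move=> x y _ _; exact: (pcan_inj (@pickleK_inv I)).
by apply: eq_esum => i _; rewrite pickleK_inv.
Qed.

Lemma esum_measurable (R : realType) d (T : measurableType d) (I : countType)
    (D : set I) (f : I -> T -> \bar R) :
  (forall i, D i -> measurable_fun setT (f i)) ->
  (forall i t, D i -> 0 <= f i t) ->
  measurable_fun setT (fun t => \esum_(i in D) f i t).
Proof.
move=> mf f0.
under eq_fun do (rewrite esum_nneseries; last by move=> i; exact: f0).
apply: (@ge0_emeasurable_sum _ _ _ _ (fun n t =>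
  oapp (fun i => if i \in D then f i t else 0) 0 (pickle_inv n)) xpredT).
  move=> k x _ _ /=; case: (@pickle_inv I k) => [i|] /=; last exact: lexx.
  by case: ifPn => // /set_mem; exact: f0.
move=> k _ /=; case: (@pickle_inv I k) => [i|] /=; last exact: measurable_cst.
by case: (boolP (i \in D)) => [/set_mem|_]; [exact: mf|exact: measurable_cst].
Qed.

Lemma integral_esum (R : realType) d (T : measurableType d)
    (mu : {measure set T -> \bar R}) (I : countType)
    (D : set I) (f : I -> T -> \bar R) :
  (forall i, D i -> measurable_fun setT (f i)) ->
  (forall i t, D i -> 0 <= f i t) ->
  \int[mu]_t (\esum_(i in D) f i t) = \esum_(i in D) \int[mu]_t f i t.
Proof.
move=> mf f0.
under eq_integral do (rewrite esum_nneseries; last by move=> i; exact: f0).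
rewrite integral_nneseries//; last 2 first.
- move=> n; case: (@pickle_inv I n) => //= i.
  by case: (boolP (i \in D)) => // /set_mem; exact: mf.
- by move=> n t _; case: (@pickle_inv I n) => //= i; case: ifPn => // /set_mem; exact: f0.
rewrite esum_nneseries; last by move=> i Di; apply: integral_ge0 => t _; exact: f0.
apply: eq_eseriesr => n _; case: (@pickle_inv I n) => /= [i|]; last by rewrite integral0.
by case: (boolP (i \in D)) => // _; rewrite integral0.
Qed.

Lemma esum_ge_term (R : realType) (I : choiceType) (D : set I)
    (f : I -> \bar R) (i : I) : D i -> f i <= \esum_(j in D) f j.
Proof.
move=> Di; apply: esum_ge; exists [set i]; first by split => // _ ->.
by rewrite fsbig_set1.
Qed.

(** For real [c] this is linearity of series. For [c = +oo], both sides are 0 if all terms vanish,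
    and otherwise a single positive term makes both infinite. *)
Lemma esumZl (R : realType) (I : countType) (D : set I) (f : I -> \bar R) c :
  (forall i, D i -> 0 <= f i) -> 0 <= c ->
  \esum_(i in D) (c * f i) = c * \esum_(i in D) f i.
Proof.
move=> f0 c0.
have fg0 : forall i, D i -> 0 <= c * f i by move=> i Di; rewrite mule_ge0// f0.
have rl r : (0 <= r)%R ->
    \esum_(i in D) (r%:E * f i) = r%:E * \esum_(i in D) f i.
  move=> r0; rewrite !esum_nneseries//; last by move=> i Di; rewrite mule_ge0// f0.
  rewrite -nneseriesZl; last first.
    by move=> n _; case: pickle_inv => //= i; case: ifPn => // /set_mem; exact: f0.
  apply: eq_eseriesr => n _; case: pickle_inv => /= [i|]; last by rewrite mule0.
  by case: ifPn => //; rewrite mule0.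
case: c c0 fg0 => // [r r0 _|_ fg0]; first exact: rl.
have [/[dup] fz ->|fn0] := eqVneq (\esum_(i in D) f i) 0.
  rewrite mule0 esum1// => i Di; suff -> : f i = 0 by rewrite mule0.
  by apply/eqP; rewrite eq_le f0// andbT -fz esum_ge_term.
rewrite gt0_mulye ?lt0e ?fn0 ?esum_ge0//.
have [i Di fi0] : exists2 i, D i & f i != 0.
  apply/not_exists2P => h; case/eqP: fn0; apply: esum1 => i Di.
  by case: (h i) => // /negP; rewrite negbK => /eqP.
apply/eqP; rewrite eq_le leey/=; apply: (le_trans _ (@esum_ge_term _ _ D _ i Di)).
by rewrite gt0_mulye// lt0e fi0 f0.
Qed.

Lemma esumZr (R : realType) (I : countType) (D : set I) (f : I -> \bar R) c :
  (forall i, D i -> 0 <= f i) -> 0 <= c ->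
  \esum_(i in D) (f i * c) = (\esum_(i in D) f i) * c.
Proof.
by move=> f0 c0; rewrite muleC -esumZl//; apply: eq_esum => i _; rewrite muleC.
Qed.

(** * The second Borel-Cantelli lemma *)

(** An algebraic substitute for [1 - x <= exp (- x)]: it bounds the product by the inverse of one
    plus the sum. In the induction the bound only decreases, by [q * (p i * (p i + r))]. *)
Lemma prod_onem_le (R : realFieldType) (p : nat -> R) (s : seq nat) :
  (forall i, 0 <= p i <= 1)%R ->
  (\prod_(i <- s) (1 - p i) * (1 + \sum_(i <- s) p i) <= 1)%R.
Proof.
move=> p01; elim: s => [|i s ih]; first by rewrite !big_nil addr0 mulr1.
rewrite !big_cons; have /andP[p0 p1] := p01 i.
set q := (\prod_(j <- s) _)%R in ih *; set r := (\sum_(j <- s) _)%R in ih *.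
have q0 : (0 <= q)%R.
  by apply: prodr_ge0 => j _; rewrite subr_ge0; case/andP: (p01 j).
have r0 : (0 <= r)%R by apply: sumr_ge0 => j _; case/andP: (p01 j).
apply: le_trans ih; rewrite -subr_ge0.
suff -> : (q * (1 + r) - (1 - p i) * q * (1 + (p i + r)) =
           q * (p i * (p i + r)))%R by rewrite !mulr_ge0// addr_ge0.
by ring.
Qed.

(** Otherwise the first [m] terms plus [M] would bound every partial sum. *)
Lemma nneseries_pinfty_unbounded (R : realType) (p : nat -> R) (m : nat) (M : R) :
  (forall i, 0 <= p i)%R -> \sum_(k <oo) (p k)%:E = +oo ->
  exists n, (M <= \sum_(m <= i < n) p i)%R.
Proof.
move=> p0 poo; apply: contrapT => /forallNP h.
suff : \sum_(k <oo) (p k)%:E <= (\sum_(0 <= i < m) p i + M)%:E by rewrite poo.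
apply: lime_le; first by apply: is_cvg_nneseries => i _ _; rewrite lee_fin.
apply: nearW => n; rewrite sumEFin lee_fin.
have [nm|mn] := leqP n m.
  rewrite (big_cat_nat _ nm)//= -addrA lerDl addr_ge0 ?sumr_ge0//.
  (* The empty block has sum 0, which shows that [M] is positive. *)
  by have /negP := h 0%N; rewrite -ltNge big_geq// => /ltW.
rewrite (big_cat_nat _ (ltnW mn))//= lerD2l.
by have /negP := h n; rewrite -ltNge => /ltW.
Qed.

Lemma harmonic_nneseries (R : realType) (c : R) : (0 < c)%R ->
  \sum_(k <oo) (c * k.+1%:R^-1)%:E = +oo.
Proof.
move=> c0; under eq_eseriesr do rewrite EFinM.
rewrite nneseriesZl; last by move=> i _; rewrite lee_fin invr_ge0.
suff -> : \sum_(i <oo) (i.+1%:R^-1)%:E = +oo :> \bar R by rewrite gt0_muley.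
apply/eqP; rewrite eq_le leey/= leNgt; apply/negP => hlt.
apply: (@dvg_harmonic R); apply: nondecreasing_is_cvgn.
  apply/nondecreasing_seqP => n; rewrite seriesEnat/= big_nat_recr//= lerDl.
  by rewrite invr_ge0.
exists (fine (\sum_(i <oo) (i.+1%:R^-1)%:E)) => _ [n _ <-].
rewrite seriesEnat/= -lee_fin fineK; last first.
  rewrite ge0_fin_numE//; apply: nneseries_ge0 => i _ _.
  by rewrite lee_fin invr_ge0.
rewrite -sumEFin; apply: nneseries_lim_ge => i _ _.
by rewrite lee_fin invr_ge0.
Qed.

Lemma bigcap_nil (I : choiceType) T (F : I -> set T) :
  \bigcap_(i in [set` [::]]) F i = setT.
Proof. by rewrite bigcap_seq big_nil. Qed.

Lemma bigcap_cons (I : choiceType) T (F : I -> set T) (x : I) (s : seq I) :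
  \bigcap_(i in [set` x :: s]) F i = F x `&` \bigcap_(i in [set` s]) F i.
Proof. by rewrite !bigcap_seq big_cons. Qed.

Lemma bigcap_cat (I : choiceType) T (F : I -> set T) (s1 s2 : seq I) :
  \bigcap_(i in [set` s1 ++ s2]) F i =
  (\bigcap_(i in [set` s1]) F i) `&` \bigcap_(i in [set` s2]) F i.
Proof. by rewrite !bigcap_seq big_cat. Qed.

Lemma bigcap_map (I J : choiceType) S (f : I -> J) (F : J -> set S) (s : seq I) :
  \bigcap_(j in [set` map f s]) F j = \bigcap_(i in [set` s]) F (f i).
Proof. by rewrite !bigcap_seq big_map. Qed.

Section borel_cantelli_independent.
Context d (T : measurableType d) (R : realType) (P : probability T R).
Variable A : nat -> set T.
Hypothesis mA : forall i, measurable (A i).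
Hypothesis indepA : forall J : seq nat, uniq J ->
  P (\bigcap_(i in [set` J]) A i) = \prod_(i <- J) P (A i).

Let p i := fine (P (A i)).

Let pE i : P (A i) = (p i)%:E.
Proof. by rewrite fineK// fin_num_measure. Qed.

Let p01 i : (0 <= p i <= 1)%R.
Proof. by rewrite -!lee_fin -pE measure_ge0 probability_le1. Qed.

(** Complements are introduced one at a time: P(E \ A_k) = P(E) - P(E & A_k), where the last term
    moves [k] from [K] to [J]. This is why the induction on [K] keeps [J] general. *)
Lemma probability_bigcap_setC (K J : seq nat) : uniq (J ++ K) ->
  P ((\bigcap_(i in [set` J]) A i) `&` (\bigcap_(i in [set` K]) ~` A i)) =
  ((\prod_(i <- J) p i) * \prod_(i <- K) (1 - p i))%:E.
Proof.
elim: K J => [|k K ih] J.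
  rewrite cats0 => uJ; rewrite bigcap_nil setIT big_nil mulr1 indepA//.
  by rewrite -prodEFin; apply: eq_bigr.
rewrite cat_uniq => /and3P[uJ /= + /andP[kK uK]].
rewrite negb_or => /andP[kJ JK].
have uJK : uniq (J ++ K) by rewrite cat_uniq uJ JK uK.
have ukJK : uniq ((k :: J) ++ K).
  by rewrite /= mem_cat (negbTE kJ) (negbTE kK).
have mI (B : nat -> set T) (L : seq nat) : (forall i, measurable (B i)) ->
    measurable (\bigcap_(i in [set` L]) B i).
  by move=> mB; apply: bigcap_measurableType => // _ _; exact: mB.
set E := (\bigcap_(i in [set` J]) A i) `&` (\bigcap_(i in [set` K]) ~` A i).
have mE : measurable E by apply: measurableI; apply: mI => // i; exact: measurableC.
have -> : (\bigcap_(i in [set` J]) A i) `&` (\bigcap_(i in [set` k :: K]) ~` A i)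
    = E `\` A k.
  by rewrite bigcap_cons setDE /E -!setIA [X in _ `&` X]setIC.
have -> : P (E `\` A k) = P E - P (E `&` A k).
  by apply: measureD => //; rewrite -ge0_fin_numE// fin_num_measure.
have -> : E `&` A k =
    (\bigcap_(i in [set` k :: J]) A i) `&` (\bigcap_(i in [set` K]) ~` A i).
  by rewrite bigcap_cons setIC setIA.
rewrite /E ih// ih// !big_cons -EFinB; congr EFin; ring.
Qed.

(** Each tail union has full probability: missing all events of index in [m, n) has as probability a
    product of 1 - p_i, which [prod_onem_le] makes arbitrarily small. *)
Lemma lim_sup_set_independent :
  \sum_(k <oo) P (A k) = +oo -> P (lim_sup_set A) = 1.
Proof.
move=> poo.
have mU n : measurable (\bigcup_(j >= n) A j) by apply: bigcup_measurable.
suff h m : P (~` \bigcup_(j >= m) A j) = 0.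
  have mS : measurable (lim_sup_set A) by apply: bigcap_measurableType => // *; exact: mU.
  have : P (~` lim_sup_set A) = 0.
    apply/negligibleP; first exact: measurableC.
    rewrite /lim_sup_set setC_bigcap; apply: negligible_bigcup => m.
    by apply/negligibleP; [exact: measurableC|exact: h].
  rewrite probability_setC// => /eqP; rewrite sube_eq ?fin_num_measure//.
  by rewrite add0e => /eqP <-.
have [r r0 PE] : exists2 r : R, (0 <= r)%R & P (~` \bigcup_(j >= m) A j) = r%:E.
  exists (fine (P (~` \bigcup_(j >= m) A j))); first exact/fine_ge0/measure_ge0.
  by rewrite fineK// fin_num_measure//; exact: measurableC.
rewrite PE; congr EFin; apply/eqP; rewrite eq_le r0 andbT leNgt; apply/negP => rp.
have poo' : \sum_(k <oo) (p k)%:E = +oo by rewrite -poo; apply: eq_eseriesr.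
(* The value 1/r is chosen for the contradiction: a sum at least 1/r would give r * (1 + 1/r) = r +
   1 <= 1 in [prod_onem_le]. *)
have [n hn] := @nneseries_pinfty_unbounded R p m r^-1 (fun i => (andP (p01 i)).1) poo'.
have hr : (r <= \prod_(m <= i < n) (1 - p i))%R.
  rewrite -lee_fin -PE.
  have := @probability_bigcap_setC (index_iota m n) [::] (iota_uniq _ _).
  rewrite bigcap_nil setTI big_nil mul1r => <-.
  apply: le_measure; rewrite ?inE; first exact: measurableC.
    by apply: bigcap_measurableType => // i _; exact: measurableC.
  rewrite setC_bigcup => t h i /=; rewrite mem_index_iota => /andP[mi _].
  exact: h.
have := @prod_onem_le _ p (index_iota m n) p01.
apply/negP; rewrite -ltNge.
apply: (@lt_le_trans _ _ (r * (1 + r^-1))%R).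
  by rewrite mulrDr mulr1 divff ?gt_eqF// ltrDr.
by rewrite ler_pM// ?(ltW rp) ?addr_ge0 ?invr_ge0 ?(ltW rp)// lerD2l.
Qed.

End borel_cantelli_independent.

(** * Coordinates, extended reals and one-term sums *)

Lemma measurable_coord (I : Type) (R : realType) (i : I) :
  measurable_fun [set: g_sigma_algebraType (@cylinders I R)]
    (fun f : g_sigma_algebraType (@cylinders I R) => (f : I -> \bar R) i).
Proof.
move=> _ Y mY; apply: sub_sigma_algebra.
by exists i => //; exists Y.
Qed.

Lemma ltNye_add (R : realDomainType) (x y : \bar R) :
  (-oo < x + y) = (-oo < x) && (-oo < y).
Proof. by rewrite !ltNye adde_eq_ninfty negb_or. Qed.

Lemma esum_if_eq (R : realType) (I : choiceType) (D : set I) (i : I) (c : \bar R) :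
  D i -> 0 <= c -> \esum_(j in D) (if j == i then c else 0) = c.
Proof.
move=> Di c0; rewrite (esumID [set i]); last by move=> j _; case: ifP.
have -> : D `&` [set i] = [set i] by apply/seteqP; split=> // j /= ->.
rewrite esum_set1 ?eqxx// esum1 ?adde0// => j [_ /= ji].
by case: eqP.
Qed.

(** * The second moment method *)

Section random_counting.
Context d (T : measurableType d) (R : realType) (P : probability T R).
Variables (I : countType) (D : set I) (B : I -> set T).
Hypothesis mB : forall i, measurable (B i).

Let N t := \esum_(i in D) (\1_(B i) t)%:E : \bar R.

Let mindic (A : set T) : measurable A ->
  measurable_fun setT (fun t => (\1_A t)%:E : \bar R).
Proof. by move=> mA; apply/measurable_EFinP; exact: measurable_indic. Qed.

Let ind0 (A : set T) t : 0 <= (\1_A t)%:E :> \bar R.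
Proof. by rewrite lee_fin. Qed.

Lemma measurable_esum_indic : measurable_fun setT N.
Proof. by apply: esum_measurable => // i _; exact: mindic. Qed.

Lemma integral_esum_indic : \int[P]_t N t = \esum_(i in D) P (B i).
Proof.
rewrite integral_esum//; last by move=> i _; exact: mindic.
by apply: eq_esum => i _; rewrite integral_indic// setIT.
Qed.

(** The square of a count is a count of pairs; Tonelli is applied to each of the two sums. *)
Lemma integral_esum_indic_sqr :
  \int[P]_t (N t * N t) = \esum_(i in D) \esum_(j in D) P (B i `&` B j).
Proof.
have N0 t : 0 <= N t by apply: esum_ge0.
under eq_integral => t _ do rewrite {1}/N -esumZr//.
rewrite integral_esum//; last 2 first.
- move=> i _; apply: emeasurable_funM; first exact: mindic.
  exact: measurable_esum_indic.
- by move=> i t _; rewrite mule_ge0.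
apply: eq_esum => i _.
under eq_integral => t _ do rewrite /N -esumZl//.
rewrite integral_esum//; last first.
  by move=> j _; apply: emeasurable_funM; exact: mindic.
apply: eq_esum => j _.
rewrite -[B i `&` B j]setIT -integral_indic//; last exact: measurableI.
by apply: eq_integral => t _; rewrite -EFinM indicI.
Qed.

(* Cauchy-Schwarz for N = N * 1_(N > 0), through 2 N <= N^2 / M + M 1_(N > 0). *)
Lemma second_moment_lower_bound (M : R) : (0 < M)%R ->
  \int[P]_t N t = 1 -> \int[P]_t (N t * N t) <= M%:E ->
  (M^-1)%:E <= P (\bigcup_(i in D) B i).
Proof.
move=> M0 N1 N2.
have N0 t : 0 <= N t by apply: esum_ge0.
set S := \bigcup_(i in D) B i.
have mS : measurable S.
  rewrite /S bigcup_mkcond; apply: countable_bigcupT_measurable => [|i].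
    exact: countableP.
  by case: ifP.

have pw t : 2%:E * N t <= (M^-1)%:E * (N t * N t) + M%:E * (\1_S t)%:E.
  have [St|nSt] := pselect (S t); last first.
    suff -> : N t = 0 by rewrite !mule0 add0e mule_ge0// lee_fin ltW.
    apply: esum1 => i Di; rewrite indicE memNset// => Bit.
    by apply: nSt; exists i.
  rewrite indicE mem_set// mule1.
  (* The count may be infinite, and then the right-hand side is [+oo] as well; for a real count one
     completes the square. *)
  case: (N t) (N0 t) => [r| |]//; last first.
    by move=> _; rewrite mulyy !gt0_muley ?lte_fin ?invr_gt0// addye// leey.
  rewrite lee_fin => r0; rewrite -!EFinM -EFinD lee_fin -subr_ge0.
  suff -> : (M^-1 * (r * r) + M - 2 * r = M^-1 * (r - M) ^+ 2)%R.
    by rewrite mulr_ge0 ?sqr_ge0// invr_ge0 ltW.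
  by field; rewrite gt_eqF.
have mN := measurable_esum_indic.
have mNN : measurable_fun setT (fun t => N t * N t) by apply: emeasurable_funM.
have iM0 : (0 <= M^-1)%R by rewrite invr_ge0 ltW.
have NN0 t : 0 <= N t * N t by rewrite mule_ge0.
have h : 2%:E <= (M^-1)%:E * \int[P]_t (N t * N t) + M%:E * P S.
  rewrite -[2%:E]mule1 -N1 -[in M%:E * _](setIT S) -integral_indic//.
  rewrite -!ge0_integralZl_EFin ?(ltW M0)//; last exact: mindic.
  rewrite -ge0_integralD//; last 4 first.
  - by move=> t _; rewrite mule_ge0.
  - exact: measurable_funeM.
  - by move=> t _; rewrite mule_ge0// lee_fin ltW.
  - by apply: measurable_funeM; exact: mindic.
  apply: ge0_le_integral => //.
  - by move=> t _; rewrite mule_ge0.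
  - exact: measurable_funeM.
  - by apply: emeasurable_funD; apply: measurable_funeM => //; exact: mindic.
have PSE : P S = (fine (P S))%:E by rewrite fineK// fin_num_measure.
move: h; rewrite PSE; set s := fine _ => h.
(* The bound on the second moment makes the quadratic term at most 1, which leaves 1 <= M * s. *)
have {}h : 2%:E <= (1 + M * s)%R%:E.
  rewrite [leRHS]EFinD EFinM; apply: (le_trans h); rewrite leeD2r//.
  apply: (@le_trans _ _ ((M^-1)%:E * M%:E)); first by rewrite lee_wpmul2l.
  by rewrite -EFinM mulVf ?gt_eqF.
rewrite lee_fin -(ler_pM2l M0) divff ?gt_eqF//.
by move: h; rewrite lee_fin; lra.
Qed.

End random_counting.

(** * Survival of critical branching random walks *)

Lemma word_size0 : [set u : word | size u = 0%N] = [set [::]].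
Proof. by apply/seteqP; split=> [[]|_ ->]. Qed.

Lemma esum_word_rcons (R : realType) (n : nat) (f : word -> \bar R) :
  (forall u, 0 <= f u) ->
  \esum_(w in [set w : word | size w = n.+1]) f w =
  \esum_(u in [set u : word | size u = n]) \esum_(k in [set: nat]) f (rcons u k).
Proof.
move=> f0; rewrite esum_esum//.
apply: (reindex_esum _ _ (fun x : word * nat => rcons x.1 x.2)); split.
- by move=> [u k] [/= su _]; rewrite size_rcons su.
- move=> [u k] [v l] _ _ /= /eqP.
  by rewrite eqseq_rcons => /andP[/eqP-> /eqP->].
- move=> w /=; case/lastP: w => // u k; rewrite size_rcons => -[su].
  by exists (u, k).
Qed.

Section survival.
Context d (T : measurableType d) (R : realType) (P : probability T R).
Variable z : word -> {RV P >-> eseq R}.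

(** This event looks only at the offspring sequence of [u], whether or not [u] itself is alive, so
    it lies in the sigma-algebra of [z u]. *)
Definition child (u : word) (k : nat) : set T := [set t | -oo < z u t k].

Definition alive (u : word) : set T := [set t | -oo < brw z t u].

Lemma brw_rcons t u k : brw z t (rcons u k) = brw z t u + z u t k.
Proof.
rewrite /brw size_rcons big_ord_recr/=; congr (_ + _).
  apply: eq_bigr => i _; rewrite -cats1 takel_cat ?(ltnW (ltn_ord i))//.
  by rewrite nth_cat ltn_ord.
by rewrite -cats1 take_size_cat// nth_cat ltnn subnn.
Qed.

Lemma alive_nil : alive [::] = setT.
Proof. by apply/seteqP; split=> // t _; rewrite /alive/= /brw big_ord0 ltNy0. Qed.

Lemma alive_rcons u k : alive (rcons u k) = alive u `&` child u k.
Proof.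
apply/seteqP; split=> t; rewrite /alive/= brw_rcons ltNye_add => /andP//.
Qed.

Lemma alive_child k : alive [:: k] = child [::] k.
Proof. by rewrite -[[:: k]]/(rcons [::] k) alive_rcons alive_nil setTI. Qed.

Let measurable_gtNy : measurable [set x : \bar R | -oo < x].
Proof.
have -> : [set x : \bar R | -oo < x] = ~` [set -oo].
  by apply/seteqP; split=> x /=; rewrite ltNye => /eqP.
exact: measurableC.
Qed.

Lemma child_preimage u k :
  child u k = z u @^-1` [set f : eseq R | -oo < (f : nat -> \bar R) k].
Proof. by []. Qed.

Lemma measurable_live k :
  measurable [set f : eseq R | -oo < (f : nat -> \bar R) k].
Proof.
by have := @measurable_coord nat R k measurableT _ measurable_gtNy; rewrite setTI.
Qed.

Lemma sigma_child u k : g_sigma_algebra_preimage (z u) (child u k).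
Proof.
exists [set f : eseq R | -oo < (f : nat -> \bar R) k]; first exact: measurable_live.
by rewrite setTI.
Qed.

Lemma sigma_setI u (A B : set T) : g_sigma_algebra_preimage (z u) A ->
  g_sigma_algebra_preimage (z u) B -> g_sigma_algebra_preimage (z u) (A `&` B).
Proof.
move=> [A' mA' <-] [B' mB' <-]; exists (A' `&` B'); first exact: measurableI.
by rewrite !setTI preimage_setI.
Qed.

Lemma measurable_sigma u (A : set T) :
  g_sigma_algebra_preimage (z u) A -> measurable A.
Proof. by move=> [B mB <-]; rewrite setTI; exact: measurable_funPTI. Qed.

Lemma measurable_child u k : measurable (child u k).
Proof. exact: measurable_sigma (sigma_child u k). Qed.

Lemma measurable_alive u : measurable (alive u).
Proof.
elim/last_ind: u => [|u k ih]; first by rewrite alive_nil.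
by rewrite alive_rcons; apply: measurableI => //; exact: measurable_child.
Qed.

(* The rectangles generating the sigma-algebra of the first n generations. *)
Definition past (n : nat) (E : set T) : Prop :=
  exists (J : seq word) (C : word -> set T),
    [/\ uniq J, forall w, w \in J -> (size w < n)%N,
        forall w, w \in J -> g_sigma_algebra_preimage (z w) (C w) &
        E = \bigcap_(w in [set` J]) C w].

Lemma past_setT n : past n setT.
Proof. by exists [::], (fun=> setT); split => //; rewrite bigcap_nil. Qed.

Lemma sigma_setT u : g_sigma_algebra_preimage (z u) setT.
Proof. by exists setT => //; rewrite setTI preimage_setT. Qed.

Lemma past_sigma n u E : (size u < n)%N ->
  g_sigma_algebra_preimage (z u) E -> past n E.
Proof.
move=> un uE; exists [:: u], (fun=> E); split => //.
- by move=> w; rewrite inE => /eqP ->.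
- by move=> w; rewrite inE => /eqP ->.
- by rewrite bigcap_cons bigcap_nil setIT.
Qed.

Lemma past_setI n E F : past n E -> past n F -> past n (E `&` F).
Proof.
move=> [J [C [uJ Jn sC ->]]] [K [D [uK Kn sD ->]]].
(* A word in both lists carries both constraints in one event; [setT] stands in for a list that
   misses it. *)
exists (undup (J ++ K)), (fun w => (if w \in J then C w else setT) `&`
                                   (if w \in K then D w else setT)).
split.
- exact: undup_uniq.
- by move=> w; rewrite mem_undup mem_cat => /orP[/Jn|/Kn].
- move=> w _; apply: sigma_setI.
    by case: ifPn => [/sC//|_]; exact: sigma_setT.
  by case: ifPn => [/sD//|_]; exact: sigma_setT.
- apply/seteqP; split=> t.
    move=> [h1 h2] w _; split; case: ifPn => // h; [exact: h1|exact: h2].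
  move=> h; split=> w /= wJ.
    by have := h w; rewrite /= mem_undup mem_cat wJ => /(_ isT) [].
  by have := h w; rewrite /= mem_undup mem_cat wJ orbT => /(_ isT) [].
Qed.

(** Being alive involves only the offspring sequences at proper prefixes of [u], whose lengths are
    below [n] even when [u] has length [n]. *)
Lemma past_alive n u : (size u <= n)%N -> past n (alive u).
Proof.
elim/last_ind: u => [|u k ih]; first by rewrite alive_nil => _; exact: past_setT.
rewrite size_rcons => un; rewrite alive_rcons; apply: past_setI.
  exact/ih/ltnW.
exact: past_sigma un (sigma_child u k).
Qed.

Hypothesis hz : iid_reproduction z.

(** Words of length below [n] never coincide with words of length [n], so mutual independence
    applies to the concatenated list and to each half. *)
Lemma past_independent n E (L : seq word) (C : word -> set T) : past n E ->
  uniq L -> (forall w, w \in L -> size w = n) ->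
  (forall w, w \in L -> g_sigma_algebra_preimage (z w) (C w)) ->
  P (E `&` \bigcap_(w in [set` L]) C w) = P E * \prod_(w <- L) P (C w).
Proof.
move=> [J [D [uJ Jn sD ->]]] uL Ln sC.
pose F w := if (size w < n)%N then D w else C w.
have EJ : \bigcap_(w in [set` J]) D w = \bigcap_(w in [set` J]) F w.
  by apply: eq_bigcapr => w /= /Jn wn; rewrite /F wn.
have EL : \bigcap_(w in [set` L]) C w = \bigcap_(w in [set` L]) F w.
  by apply: eq_bigcapr => w /= /Ln wn; rewrite /F wn ltnn.
have FJ w : w \in J -> g_sigma_algebra_preimage (z w) (F w).
  by move=> wJ; rewrite /F (Jn _ wJ); exact: sD.
have FL w : w \in L -> g_sigma_algebra_preimage (z w) (F w).
  by move=> wL; rewrite /F (Ln _ wL) ltnn; exact: sC.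
have [_ _ ind _] := hz.
rewrite EJ EL -bigcap_cat !ind//; last 2 first.
- rewrite cat_uniq uJ uL andbT; apply/hasPn => w wL; apply/negP => /Jn.
  by rewrite (Ln _ wL) ltnn.
- by move=> w; rewrite mem_cat => /orP[/FJ|/FL].
rewrite big_cat; congr (_ * _); apply: eq_big_seq => w /Ln wn.
by rewrite /F wn ltnn.
Qed.

Lemma brw_lty t u : brw z t u < +oo.
Proof.
have [_ zoo _ _] := hz.
elim/last_ind: u => [|u k ih]; first by rewrite /brw big_ord0 ltry.
by rewrite brw_rcons lte_add_pinfty.
Qed.

(** Positions are below [+oo], so [edirac] has total mass 1 exactly at living vertices. *)
Lemma generationE n t : generation (brw z) n t setT =
  \esum_(u in [set u : word | size u = n]) (\1_(alive u) t)%:E.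
Proof.
apply: eq_esum => u _; rewrite /edirac indicE.
have := brw_lty t u; have : (t \in alive u) = (-oo < brw z t u).
  by apply/idP/idP => [/set_mem//|h]; exact: mem_set.
case: (brw z t u) => [r| |]// -> _; last by rewrite ltxx.
by rewrite ltNyr diracT.
Qed.

Lemma child_root u k : P (child u k) = P (child [::] k).
Proof.
have [_ _ _ id] := hz.
by rewrite !child_preimage; exact: id (measurable_live k).
Qed.

Lemma child_rootI u k l :
  P (child u k `&` child u l) = P (child [::] k `&` child [::] l).
Proof.
have [_ _ _ id] := hz.
rewrite !child_preimage -!preimage_setI; apply: id.
by apply: measurableI; exact: measurable_live.
Qed.

Hypothesis critical : psi P (brw z) 0 = 0.

(** At exponent 0 the integrand in [psi] counts the living children of the root, and a vanishing
    logarithm means that their mean number is 1. *)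
Lemma sum_child : \esum_(k in [set: nat]) P (child [::] k) = 1.
Proof.
have /eqP := critical; rewrite /psi lne_eq0 => /eqP <-.
rewrite (_ : (fun t => _) = fun t =>
  \esum_(u in [set u : word | size u = 1%N]) (\1_(alive u) t)%:E); last first.
  apply/funext => t.
  have -> : [set u : word | size u = 1%N /\ -oo < brw z t u] =
    [set u : word | size u = 1%N] `&` [set u | -oo < brw z t u] by [].
  rewrite esum_mkcondr; apply: eq_esum => u _.
  rewrite mul0e expeR0 indicE.
  have -> : (u \in [set u | -oo < brw z t u]) = (t \in alive u).
    by apply/idP/idP => /set_mem h; exact/mem_set.
  by case: (t \in _).
rewrite integral_esum_indic; last exact: measurable_alive.
rewrite (@esum_word_rcons _ 0%N)// word_size0 esum_set1; last exact: esum_ge0.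
by apply: eq_esum => k _; rewrite -alive_child.
Qed.

(** This is E Z_n = 1: the offspring of a word of length [n] is independent of its being alive and
    has mean 1. *)
Lemma sum_alive n : \esum_(u in [set u : word | size u = n]) P (alive u) = 1.
Proof.
elim: n => [|n <-].
  by rewrite word_size0 esum_set1// alive_nil probability_setT.
rewrite esum_word_rcons//; apply: eq_esum => u /= un.
rewrite -[RHS]mule1 -sum_child -esumZl//; apply: eq_esum => k _.
have := @past_independent n (alive u) [:: u] (fun=> child u k).
rewrite bigcap_cons bigcap_nil setIT big_seq1 alive_rcons child_root; apply => //.
- by apply: past_alive; rewrite un.
- by move=> w; rewrite inE => /eqP ->.
- by move=> w; rewrite inE => /eqP ->; exact: sigma_child.
Qed.

(** Distinct parents in one generation reproduce independently of each other and of the earlier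
    generations. *)
Lemma alive2_rcons n u v k l : size u = n -> size v = n -> v != u ->
  P (alive (rcons u k) `&` alive (rcons v l)) =
  P (alive u `&` alive v) * P (child [::] k) * P (child [::] l).
Proof.
move=> un vn vu.
have := @past_independent n (alive u `&` alive v) [:: u; v]
  (fun w => if w == u then child u k else child v l).
rewrite !bigcap_cons bigcap_nil setIT !big_cons big_nil mule1 eqxx (negbTE vu).
rewrite !child_root muleA !alive_rcons setIACA; apply.
- by apply: past_setI; apply: past_alive; rewrite ?un ?vn.
- by rewrite /= inE eq_sym vu.
- by move=> w; rewrite !inE => /orP[] /eqP ->.
- move=> w; rewrite !inE => /orP[] /eqP ->; first by rewrite eqxx; exact: sigma_child.
  by rewrite (negbTE vu); exact: sigma_child.
Qed.

(** Siblings share one offspring sequence, so their joint event does not factor further; it is only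
    separated from the survival of the parent. *)
Lemma alive_rcons2 u k l :
  P (alive (rcons u k) `&` alive (rcons u l)) =
  P (alive u) * P (child [::] k `&` child [::] l).
Proof.
have := @past_independent (size u) (alive u) [:: u]
  (fun=> child u k `&` child u l).
rewrite bigcap_cons bigcap_nil setIT big_seq1 child_rootI.
rewrite !alive_rcons setIACA setIid; apply => //.
- exact: past_alive.
- by move=> w; rewrite inE => /eqP ->.
- by move=> w; rewrite inE => /eqP ->; apply: sigma_setI; exact: sigma_child.
Qed.

(** The expectation of Z_1 on the event that child [k] of the root is alive; summed over [k] it
    gives E Z_1^2. *)
Let q k := \esum_(l in [set: nat]) P (child [::] k `&` child [::] l).

Lemma integral_generation1_sqr :
  \int[P]_t (generation (brw z) 1 t setT) ^+ 2 = \esum_(k in [set: nat]) q k.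
Proof.
under eq_integral => t _ do rewrite expe2 generationE.
rewrite integral_esum_indic_sqr; last exact: measurable_alive.
rewrite (@esum_word_rcons _ 0%N); last by move=> u; exact: esum_ge0.
rewrite word_size0 esum_set1; last by apply: esum_ge0 => *; apply: esum_ge0.
apply: eq_esum => k _; rewrite (@esum_word_rcons _ 0%N)// word_size0 esum_set1.
  by apply: eq_esum => l _; rewrite -!alive_child.
exact: esum_ge0.
Qed.

Lemma second_moment n (c : R) :
  \int[P]_t (generation (brw z) 1 t setT) ^+ 2 = c%:E ->
  \esum_(u in [set u : word | size u = n]) \esum_(v in [set v : word | size v = n])
    P (alive u `&` alive v) <= (1 + n%:R * c)%R%:E.
Proof.
rewrite integral_generation1_sqr => qc.
have q0 k : 0 <= q k by exact: esum_ge0.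
elim: n => [|n ih].
  rewrite word_size0 !esum_set1//.
  by rewrite alive_nil setIT probability_setT mul0r addr0.
set S := fun n (u : word) =>
  \esum_(v in [set v : word | size v = n]) P (alive u `&` alive v) in ih *.
have S0 m u : 0 <= S m u by exact: esum_ge0.
(* The first term covers parents v different from [u], the second v = [u]. Keeping the diagonal term
   in [S n u] is what makes this an inequality. *)
have inner u k : size u = n ->
    S n.+1 (rcons u k) <= P (child [::] k) * S n u + P (alive u) * q k.
  move=> un; rewrite /S esum_word_rcons//.
  (* The diagonal contribution is written as a sum over v supported at [u], so that both sides are
     compared term by term. *)
  rewrite -[X in _ + X](@esum_if_eq _ _ [set v : word | size v = n] u)//; last first.
    by rewrite mule_ge0.
  rewrite -esumZl//.
  rewrite -esumD//; last 2 first.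
  - by move=> v _; rewrite mule_ge0.
  - by move=> v _; case: ifP => // _; rewrite mule_ge0.
  apply: le_esum => v /= vn; have [->|vu] := eqVneq v u.
    under eq_esum do rewrite alive_rcons2.
    by rewrite esumZl// leeDr// mule_ge0.
  under eq_esum do rewrite (@alive2_rcons n)//.
  by rewrite esumZl// ?mule_ge0// sum_child mule1 adde0 muleC.
rewrite esum_word_rcons; last exact: S0.
apply: (@le_trans _ _ (\esum_(u in [set u : word | size u = n])
    (S n u + P (alive u) * c%:E))).
  apply: le_esum => u /= un.
  apply: (@le_trans _ _ (\esum_(k in [set: nat])
      (P (child [::] k) * S n u + P (alive u) * q k))).
    by apply: le_esum => k _; exact: inner.
  rewrite esumD//; last 2 first.
  - by move=> k _; rewrite mule_ge0.
  - by move=> k _; rewrite mule_ge0.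
  by rewrite esumZr// esumZl// sum_child mul1e qc.
have c0 : 0 <= c%:E by rewrite -qc; exact: esum_ge0.
rewrite esumD//; last by move=> u _; rewrite mule_ge0.
rewrite esumZr// sum_alive mul1e.
apply: (le_trans (leeD2r _ ih)).
by rewrite -EFinD lee_fin -addrA -natr1 mulrDl mul1r.
Qed.

Definition survival n : set T :=
  \bigcup_(u in [set u : word | size u = n]) alive u.

(** The second moment method with M = 1 + n c, weakened to (1 + c)(n + 1) so that the bound is a
    constant times a harmonic term. *)
Lemma survival_lower_bound (c : R) n :
  \int[P]_t (generation (brw z) 1 t setT) ^+ 2 = c%:E ->
  ((1 + c)^-1 * n.+1%:R^-1)%:E <= P (survival n).
Proof.
move=> hc.
have c0 : (0 <= c)%R.
  rewrite -lee_fin -hc; apply: integral_ge0 => t _.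
  by rewrite expe2 mule_ge0// generationE; exact: esum_ge0.
have nc0 : (0 < 1 + n%:R * c)%R by rewrite ltr_pwDl// mulr_ge0.
apply: (@le_trans _ _ ((1 + n%:R * c)^-1)%:E).
  rewrite lee_fin -invfM lef_pV2 ?posrE// ?mulr_gt0//; last first.
    by rewrite ltr_pwDl.
  have n0 : (0 <= n%:R :> R)%R by [].
  by rewrite -natr1; nra.
apply: second_moment_lower_bound => //.
- exact: measurable_alive.
- by rewrite integral_esum_indic ?sum_alive//; exact: measurable_alive.
- by rewrite integral_esum_indic_sqr; [exact: second_moment|exact: measurable_alive].
Qed.

End survival.

(** * Measurability and integration tools *)

Lemma measurable_expeR (R : realType) : measurable_fun setT (@expeR R).
Proof.
(* [er_map] fixes both infinities; the maximum with 0 corrects the value at [-oo]. *)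
have -> : @expeR R = fun x => maxe 0 (er_map expR x).
  apply/funext => -[r| |]; apply/esym.
  - by apply/max_idPr; rewrite lee_fin expR_ge0.
  - by apply/max_idPr; exact: leey.
  - by apply/max_idPl; exact: leNye.
apply: measurable_maxe; first exact: measurable_cst.
exact: (measurable_er_map (measurableTypeR R) (@measurable_expR R)).
Qed.

(** Beyond any partial sum there is one more term of size at least 1, so the partial sums pass every
    integer. *)
Lemma nneseries_infinitely_often (R : realType) (a : nat -> \bar R) :
  (forall k, 0 <= a k) -> (forall n, exists2 k, (n <= k)%N & 1 <= a k) ->
  \sum_(k <oo) a k = +oo.
Proof.
move=> a0 ha.
have partial N : exists m, N%:R%:E <= \sum_(0 <= i < m) a i.
  elim: N => [|N [m hm]]; first by exists 0%N; rewrite big_geq.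
  have [k mk ak] := ha m; exists k.+1; rewrite big_nat_recr//=.
  rewrite -natr1 EFinD leeD//; apply: (le_trans hm).
  rewrite (big_cat_nat _ mk)//= leeDl//.
  by apply: sume_ge0 => i _.
apply/eqyP => r r0.
have [m hm] := partial (Num.truncn r).+1.
apply: (le_trans _ (nneseries_lim_ge m (fun n _ _ => a0 n))).
by apply: le_trans hm; rewrite lee_fin ltW// truncnS_gt.
Qed.

Lemma integral_eq0_subset d (T : measurableType d) (R : realType)
    (mu : {measure set T -> \bar R}) (f : T -> \bar R) (A : set T) :
  measurable A -> measurable_fun setT f -> (forall t, 0 <= f t) ->
  (forall t, A t -> 0 < f t) -> \int[mu]_t f t = 0 -> mu A = 0.
Proof.
move=> mA mf f0 fA if0.
have : \int[mu]_t `|f t| = 0.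
  by rewrite -if0; apply: eq_integral => t _; rewrite gee0_abs.
move=> /(ae_eq_integral_abs mu measurableT mf).1 h.
apply/negligibleP => //; apply: negligibleS h => t At /= /(_ I) ft0.
by have := fA _ At; rewrite ft0 ltxx.
Qed.

(** The index varies with the point; splitting over its countably many values reduces to fixed
    coordinates. *)
Lemma measurable_marked (R : realType) :
  measurable_fun [set: eseq R * nat] (fun x => (x.1 : nat -> \bar R) x.2).
Proof.
move=> _ Y mY; rewrite setTI.
have -> : (fun x : eseq R * nat => (x.1 : nat -> \bar R) x.2) @^-1` Y =
  \bigcup_(j in [set: nat])
    (((fun f : eseq R => (f : nat -> \bar R) j) @^-1` Y) `*` [set j]).
  apply/seteqP; split=> [[f j] /= Yf|[f j] [i _ [/= Yf ->]]] //.
  by exists j.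
apply: bigcup_measurable => j _; apply: measurableX => //.
by have := @measurable_coord nat R j measurableT _ mY; rewrite setTI.
Qed.

(** * Measurability of the walk and positive chance of a second child *)

Section branching_walk_measurability.
Context d (T : measurableType d) (R : realType) (P : probability T R).
Variable z : word -> {RV P >-> eseq R}.

Lemma measurable_brw u : measurable_fun setT (fun t => brw z t u : \bar R).
Proof.
elim/last_ind: u => [|u k ih].
  by under eq_fun do rewrite /brw big_ord0; exact: measurable_cst.
under eq_fun do rewrite brw_rcons.
apply: emeasurable_funD => //.
move=> _ Y mY; rewrite setTI.
have := @measurable_coord nat R k measurableT _ mY; rewrite setTI => mC.
exact: (measurable_funPTI (z u) mC).
Qed.

Hypothesis hz : iid_reproduction z.
Hypothesis critical : psi P (brw z) 0 = 0.

Lemma child1_sub : child z [::] 1 `<=` child z [::] 0.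
Proof.
have [mono _ _ _] := hz; move=> t; rewrite /child/= => h.
by apply: (lt_le_trans h); exact: mono.
Qed.

(* Otherwise Z_1 would be the indicator of {child 0 alive}, of mean 1. *)
Lemma child1_gt0 : P [set t | generation (brw z) 1 t setT = 1] < 1 ->
  0 < P (child z [::] 1).
Proof.
move=> hZ1; rewrite lt0e measure_ge0 andbT; apply/eqP => c1.
have [mono _ _ _] := hz.
have m0 k := measurable_child z [::] k.
(* Positions are non-increasing, so a dead second child forces all later ones to be dead. *)
have sub k : child z [::] k.+1 `<=` child z [::] 1.
  by move=> t; rewrite /child/= => h; apply: (lt_le_trans h); exact: mono.
have ck k : P (child z [::] k.+1) = 0.
  by apply: (subset_measure0 _ _ (sub k)).
have c0 : P (child z [::] 0) = 1.
  rewrite -[RHS](sum_child critical) -[LHS](@esum_if_eq R nat setT 0%N)//.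
  by apply: eq_esum => -[|k] _.
have mZ : measurable [set t | generation (brw z) 1 t setT = 1].
  rewrite -[X in measurable X]setTI.
  under eq_set do rewrite (generationE hz).
  have := @measurable_esum_indic _ _ R _ [set u : word | size u = 1%N] _
    (measurable_alive z).
  by move=> /(_ measurableT [set 1]); apply.
move: hZ1; rewrite ltNge => /negP; apply.
(* On this event exactly the first child is alive, hence Z_1 = 1. *)
have cD : P (child z [::] 0 `\` child z [::] 1) = 1.
  rewrite setDE -[LHS]adde0 -c1 -measureU//; last 2 first.
  - by apply: measurableI => //; exact: measurableC.
  - by rewrite -setIA setICl setI0.
  rewrite -[RHS]c0; congr (P _); apply/seteqP; split=> t.
    by move=> [[]//|/child1_sub].
  by have [h|h] := pselect (child z [::] 1 t); [right|left].
rewrite -[leLHS]cD; apply: le_measure; rewrite ?inE//; first exact: measurableD.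
move=> t [t0 t1] /=; rewrite (generationE hz) (@esum_word_rcons _ 0%N); last first.
  by move=> u; rewrite lee_fin.
rewrite word_size0 esum_set1; last by apply: esum_ge0 => *; rewrite lee_fin.
rewrite -[RHS](@esum_if_eq R nat setT 0%N)//.
apply: eq_esum => -[|k] _; rewrite /= alive_child indicE.
  by rewrite mem_set.
by rewrite memNset// => /sub.
Qed.

End branching_walk_measurability.

(** * The spine *)

Section spine.
Context d (T : measurableType d) (R : realType) (P : probability T R).
Variable z : word -> {RV P >-> eseq R}.
Hypothesis hz : iid_reproduction z.
Hypothesis critical : psi P (brw z) 0 = 0.
Hypothesis hZ1 : P [set t | generation (brw z) 1 t setT = 1] < 1.
Variable theta : R.
Hypothesis theta_gt0 : (0 < theta)%R.
Hypothesis psi_fin : psi P (brw z) theta < +oo.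
Context d' (T' : measurableType d') (P' : probability T' R).
Variable X : nat -> {RV P' >-> (eseq R * nat)%type}.
Hypothesis hX : forall k, size_biased P (brw z) theta (X k).
Variable W : nat -> nat -> {RV P' >-> efield R}.
Hypothesis hW : forall i k (A : set (efield R)), measurable A ->
  distribution P' (W i k) A = pushforward P (brw z) A.
Hypothesis hXW : spine_independent X W.

Lemma size_biased_prob k (B : set (eseq R * nat)) : measurable B ->
  P' (X k @^-1` B) = \int[P]_t \sum_(j <oo)
    (expeR (theta%:E * brw z t [:: j] - psi P (brw z) theta) *
     (\1_B ((fun i => brw z t [:: i]) : eseq R, j))%:E).
Proof.
move=> mB; rewrite -(hX k (f := fun x => (\1_B x)%:E)).
- rewrite -[X k @^-1` B]setIT -integral_indic//.
  by rewrite -[X in measurable X]setTI; exact: measurable_funPT.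
- by apply/measurable_EFinP; exact: measurable_indic.
- by move=> x; rewrite lee_fin.
Qed.

Definition marked_dead : set (eseq R * nat) :=
  [set x | (x.1 : nat -> \bar R) x.2 \isn't a fin_num].

Lemma measurable_marked_dead : measurable marked_dead.
Proof.
have := emeasurable_fin_num measurableT (@measurable_marked R).
rewrite setTI => /measurableC; congr (measurable _).
by apply/seteqP; split => x /negP.
Qed.

(** A dead marked child has size-biased weight 0: [theta > 0] sends [-oo] to [-oo], which absorbs
    the other summand, and the exponential vanishes there. *)
Lemma marked_dead_null k : P' (X k @^-1` marked_dead) = 0.
Proof.
rewrite size_biased_prob; last exact: measurable_marked_dead.
rewrite (_ : (fun t => _) = cst 0) ?integral0//; apply/funext => t.
apply: eseries0 => j _ _; rewrite indicE.
have [/set_mem|] := boolP (_ \in marked_dead); last by rewrite mule0.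
rewrite /marked_dead/= => dead.
have -> : brw z t [:: j] = -oo.
  by move: dead (brw_lty hz t [:: j]); case: (brw z t [:: j]).
by rewrite gt0_muleNy ?lte_fin// addNye/= mul0e.
Qed.

(** With index 0 marked, the point of index 1 is an unmarked living one, from which a side tree
    starts. *)
Definition two_children : set (eseq R * nat) :=
  [set x | [/\ (x.1 : nat -> \bar R) 0%N \is a fin_num,
               (x.1 : nat -> \bar R) 1%N \is a fin_num & x.2 = 0%N]].

Lemma measurable_coord_fin (I : Type) (i : I) :
  measurable [set f : g_sigma_algebraType (@cylinders I R) |
              (f : I -> \bar R) i \is a fin_num].
Proof.
have := emeasurable_fin_num measurableT (@measurable_coord _ R i).
by rewrite setTI.
Qed.

Lemma measurable_two_children : measurable two_children.
Proof.
have -> : two_children = ([set f : eseq R | (f : nat -> \bar R) 0%N \is a fin_num]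
    `&` [set f : eseq R | (f : nat -> \bar R) 1%N \is a fin_num]) `*` [set 0%N].
  by apply/seteqP; split=> [x [h0 h1 hx]|x [[h0 h1] hx]].
by apply: measurableX => //; apply: measurableI; exact: measurable_coord_fin.
Qed.

(** The size-biased formula gives the same integral for every [k]; this is the constant p of the
    divergent sum. *)
Lemma two_children_prob k :
  P' (X k @^-1` two_children) = P' (X 0%N @^-1` two_children).
Proof. by rewrite !size_biased_prob//; exact: measurable_two_children. Qed.

(** The probability is the integral of a weight that is positive wherever the second child of the
    root is alive; were it 0, that event would be null, against [child1_gt0]. *)
Lemma two_children_gt0 k : 0 < P' (X k @^-1` two_children).
Proof.
rewrite lt0e measure_ge0 andbT; apply/eqP; rewrite size_biased_prob; last first.
  exact: measurable_two_children.
set B := two_children; set h := fun t => _.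
pose g t := expeR (theta%:E * brw z t [:: 0%N] - psi P (brw z) theta) *
  (\1_(child z [::] 0 `&` child z [::] 1) t)%:E.
have childE t i : child z [::] i t <-> brw z t [:: i] \is a fin_num.
  rewrite -alive_child /alive/= fin_numElt (brw_lty hz) andbT.
  by split.
(* The indicator forces the mark to be 0, so only the first term of the series survives. *)
have hg t : h t = g t.
  rewrite /h /g [LHS](@nneseriesD1 _ _ 0%N)//; last first.
    by move=> j _; rewrite mule_ge0 ?expeR_ge0// lee_fin.
  rewrite eseries0 ?adde0; last first.
    move=> [|j] // _ _; rewrite indicE memNset ?mule0// /B /two_children/=.
    by case.
  congr (_ * _); rewrite !indicE; congr (_%:R%:E); congr nat_of_bool.
  apply/idP/idP => /set_mem.
    by move=> -[h0 h1 _]; apply/mem_set; split; apply/childE.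
  by move=> -[/childE h0 /childE h1]; apply/mem_set; split.
rewrite (_ : h = g); last exact/funext.
have m01 : measurable (child z [::] 0 `&` child z [::] 1).
  by apply: measurableI; exact: measurable_child.
move=> ig.
have := @integral_eq0_subset _ _ _ P g _ m01 _ _ _ ig.
rewrite setIidr; last exact: child1_sub.
have := child1_gt0 hz critical hZ1.
rewrite lt0e => /andP[/eqP c1 _] hh; apply/c1/hh => {hh}.
- apply: emeasurable_funM.
    apply: measurableT_comp; first exact: measurable_expeR.
    apply: emeasurable_funB; last exact: measurable_cst.
    by apply: measurable_funeM; exact: measurable_brw.
  by apply/measurable_EFinP; exact: measurable_indic.
- by move=> t; rewrite mule_ge0 ?expeR_ge0// lee_fin.
- move=> t t1; have t0 := child1_sub hz t1.
  (* The exponent stays above [-oo] because the first child has a finite position and [psi] at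
     [theta] is below [+oo]. *)
  rewrite /g indicE mem_set// mule1 expeR_gt0// ltNye_add.
  move/childE : t0; case: (brw z t [:: 0%N]) => // r _.
  rewrite -EFinM ltNyr/=; move: psi_fin; case: (psi _ _ _) => // s _.
  by rewrite -EFinN ltNyr.
Qed.

(** A set of fields rather than an event, so that its probability passes from [brw z] to [W 1 k]
    through equality of laws. *)
Definition reaches k : set (efield R) :=
  \bigcup_(u in [set u : word | size u = k])
    [set f : efield R | (f : word -> \bar R) u \is a fin_num].

Lemma measurable_reaches k : measurable (reaches k).
Proof.
rewrite /reaches bigcup_mkcond; apply: countable_bigcupT_measurable => [|u].
  exact: countableP.
by case: ifP => // _; exact: (@measurable_coord_fin word u).
Qed.

Lemma reaches_prob k : P' (W 1 k @^-1` reaches k) = P (survival z k).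
Proof.
have -> : P' (W 1 k @^-1` reaches k) = distribution P' (W 1 k) (reaches k) by [].
rewrite hW; last exact: measurable_reaches.
congr (P _); apply/seteqP; split=> t [u uk /= h]; exists u => //=.
  by move: h; rewrite fin_numElt => /andP[].
by rewrite fin_numElt (brw_lty hz) andbT.
Qed.

(* Always using the subtree of the second point, rather than that of an arbitrary
   unmarked one, makes these events depend on disjoint blocks of the independent
   family. *)
Definition side_tree k : set T' :=
  (X k @^-1` two_children) `&` (W 1 k @^-1` reaches k).

Lemma measurable_two_childrenX k : measurable (X k @^-1` two_children).
Proof. by have := measurable_funPTI (X k) measurable_two_children. Qed.

Lemma measurable_side_tree k : measurable (side_tree k).
Proof.
apply: measurableI; first exact: measurable_two_childrenX.
by have := measurable_funPTI (W 1 k) (measurable_reaches k).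
Qed.

Lemma side_tree_prod (J : seq nat) : uniq J ->
  P' (\bigcap_(k in [set` J]) side_tree k) =
  \prod_(k <- J) (P' (X k @^-1` two_children) * P' (W 1 k @^-1` reaches k)).
Proof.
move=> uJ.
pose F (j : nat + nat * nat) := match j with
  | inl k => X k @^-1` two_children
  | inr (i, k) => W i k @^-1` reaches k
  end.
(* The indices [inl k] and [inr (1, k)] are pairwise distinct, so a single use of
   [spine_independent] factors all the events. *)
pose L : seq (nat + nat * nat) := map inl J ++ map (fun k => inr (1%N, k)) J.
have -> : \bigcap_(k in [set` J]) side_tree k = \bigcap_(j in [set` L]) F j.
  by rewrite bigcap_cat !bigcap_map /= /side_tree bigcapI.
rewrite hXW; first by rewrite big_cat !big_map/= -big_split.
- rewrite cat_uniq !map_inj_uniq ?uJ ?andbT//=; last 2 first.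
  + by move=> k l [].
  + by move=> k l [].
  by apply/hasPn => _ /mapP[k _ ->]; apply/negP => /mapP[].
- move=> [k|[i k]] _ /=.
    by exists two_children; [exact: measurable_two_children|rewrite setTI].
  by exists (reaches k); [exact: measurable_reaches|rewrite setTI].
Qed.

Lemma side_tree_prob k :
  P' (side_tree k) = P' (X k @^-1` two_children) * P' (W 1 k @^-1` reaches k).
Proof.
have := @side_tree_prod [:: k] isT.
by rewrite bigcap_cons bigcap_nil setIT big_seq1.
Qed.

(** The [k]-th event has probability at least p / (1 + c) times 1 / (k + 1), so the sum diverges
    like the harmonic series. *)
Lemma side_tree_io (c : R) :
  \int[P]_t (generation (brw z) 1 t setT) ^+ 2 = c%:E ->
  P' (lim_sup_set side_tree) = 1.
Proof.
move=> hc; apply: lim_sup_set_independent.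
- exact: measurable_side_tree.
- move=> J uJ; rewrite side_tree_prod//.
  by apply: eq_bigr => k _; rewrite side_tree_prob.
set p := fine (P' (X 0%N @^-1` two_children)).
have pE k : P' (X k @^-1` two_children) = p%:E.
  by rewrite two_children_prob fineK// fin_num_measure//; exact: measurable_two_childrenX.
have p0 : (0 < p)%R by rewrite -lte_fin -(pE 0%N) two_children_gt0.
have c0 : (0 <= c)%R.
  rewrite -lee_fin -hc; apply: integral_ge0 => t _.
  by rewrite expe2 mule_ge0// (generationE hz); apply: esum_ge0 => *; rewrite lee_fin.
have pc0 : (0 < p * (1 + c)^-1)%R by rewrite mulr_gt0// invr_gt0 ltr_pwDl.
apply/eqP; rewrite eq_le leey/= -(harmonic_nneseries pc0).
apply: lee_nneseries => k _ //.
  by move=> _; rewrite lee_fin mulr_ge0// ltW.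
rewrite side_tree_prob pE reaches_prob -mulrA EFinM lee_pmul2l//.
exact: survival_lower_bound.
Qed.

End spine.

(** * The total mass of D *)

Section infinite_point_process.
Context (R : realType) d' (T' : measurableType d') (P' : probability T' R).
Variable X : nat -> {RV P' >-> (eseq R * nat)%type}.
Variable W : nat -> nat -> {RV P' >-> efield R}.

(** The condition that [i] is unmarked is put inside the event, which turns a series over a random
    index set into a sum of indicators over all [i]. *)
Let atom k i (u : word) : set T' :=
  [set t | i != (X k t).2] `&`
  [set t | (X k t).1 i + W i k t u - spine_walk X k.+1 t \is a fin_num].

Lemma measurable_funX_coord k i :
  measurable_fun setT (fun t => (X k t).1 i : \bar R).
Proof.
move=> _ Y mY; rewrite setTI.
have := @measurable_coord nat R i measurableT _ mY; rewrite setTI => mC.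
have := @measurable_fst _ _ (eseq R) nat measurableT _ mC; rewrite setTI => mD.
exact: (measurable_funPTI (X k) mD).
Qed.

Lemma measurable_funX_marked k :
  measurable_fun setT (fun t => (X k t).1 (X k t).2 : \bar R).
Proof.
move=> _ Y mY; rewrite setTI.
have := @measurable_marked R measurableT _ mY; rewrite setTI => mD.
exact: (measurable_funPTI (X k) mD).
Qed.

Lemma measurable_funW_coord i k u :
  measurable_fun setT (fun t => W i k t u : \bar R).
Proof.
move=> _ Y mY; rewrite setTI.
have := @measurable_coord word R u measurableT _ mY; rewrite setTI => mC.
exact: (measurable_funPTI (W i k) mC).
Qed.

Lemma measurable_spine_walk n : measurable_fun setT (spine_walk X n).
Proof. by apply: emeasurable_sum => k; exact: measurable_funX_marked. Qed.

Let measurable_atom k i u : measurable (atom k i u).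
Proof.
apply: measurableI.
  have -> : [set t | i != (X k t).2] = X k @^-1` (snd @^-1` [set j | i != j]) by [].
  apply: (measurable_funPTI (X k)).
  have := @measurable_snd _ _ (eseq R) nat measurableT [set j | i != j].
  by rewrite setTI; apply.
have := @emeasurable_fin_num _ T' R _
  (fun t => (X k t).1 i + W i k t u - spine_walk X k.+1 t) measurableT.
rewrite setTI; apply; apply: emeasurable_funB; last exact: measurable_spine_walk.
by apply: emeasurable_funD; [exact: measurable_funX_coord|exact: measurable_funW_coord].
Qed.

Let mass k t : \bar R := \esum_(i in [set: nat])
  \esum_(u in [set u : word | size u = k]) (\1_(atom k i u) t)%:E.

Let mass0 k t : 0 <= mass k t.
Proof. by apply: esum_ge0 => *; apply: esum_ge0 => *; rewrite lee_fin. Qed.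

Lemma edirac_setT (x : \bar R) :
  edirac x setT = (x \is a fin_num)%:R%:E.
Proof. by case: x => [r| |] //=; rewrite diracT. Qed.

Lemma Dinfty_setT t : Dinfty X W t setT = 1 + \sum_(k <oo) mass k t.
Proof.
rewrite /Dinfty diracT; congr (_ + _); apply: eq_eseriesr => k _.
rewrite eseries_mkcond nneseries_esumT; last first.
  move=> i; case: ifP => // _; apply: esum_ge0 => u _.
  by rewrite edirac_setT lee_fin.
apply: eq_esum => i _; case: ifPn => [ik|ik]; last first.
  by rewrite esum1// => u _; rewrite indicE memNset// => -[/=]; rewrite (negbTE ik).
apply: eq_esum => u _; rewrite edirac_setT indicE; congr (_%:R%:E).
by congr nat_of_bool; apply/idP/idP => [h|/set_mem[]//]; apply/mem_set; split.
Qed.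

Lemma measurable_Dinfty_setT :
  measurable [set t | Dinfty X W t setT = +oo].
Proof.
have mD : measurable_fun setT (fun t => Dinfty X W t setT).
  under eq_fun do rewrite Dinfty_setT.
  apply: emeasurable_funD; first exact: measurable_cst.
  apply: (@ge0_emeasurable_sum _ _ _ _ (fun k t => mass k t) xpredT) => [k t _ _|k _];
    first exact: mass0.
  apply: esum_measurable => [i _|i t _].
    exact: measurable_esum_indic.
  by apply: esum_ge0 => *; rewrite lee_fin.
by have := mD measurableT _ (emeasurable_set1 +oo); rewrite setTI.
Qed.

Lemma Dinfty_pinfty t :
  (forall k, ~ marked_dead (X k t)) -> lim_sup_set (side_tree X W) t ->
  Dinfty X W t setT = +oo.
Proof.
move=> live io.
(* The recentring must be finite: otherwise the shifted positions would be infinite and [edirac]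
   would discard them. *)
have walk n : spine_walk X n t \is a fin_num.
  apply/sum_fin_numP => k _ _; have := live k.
  by rewrite /marked_dead/= => /negP; rewrite negbK.
rewrite Dinfty_setT nneseries_infinitely_often ?addey// => n.
have [k nk [[x0 x1 xk] [u uk Wu]]] := io n I.
(* A single term suffices: the point of index 1 and the vertex [u] of its subtree in generation
   [k]. *)
exists k => //; apply: (le_trans _ (@esum_ge_term _ _ setT _ 1%N I)).
apply: (le_trans _ (@esum_ge_term _ _ [set u : word | size u = k] _ u uk)).
rewrite indicE mem_set// /atom; split => /=; first by rewrite xk.
by rewrite fin_numD fin_numN walk andbT fin_numD x1.
Qed.

End infinite_point_process.

Unset Implicit Arguments.

Theorem proposition5p2 (R : realType)
  (d : measure_display) (T : measurableType d) (P : probability T R)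
  (z : word -> {RV P >-> eseq R})
  (hz : iid_reproduction z)
  (hZ0 : P [set t | generation (brw z) 1 t setT = 0] < 1)
  (* without this, Z_1(R) = 1 a.s. satisfies all hypotheses but D = delta_0 *)
  (hZ1 : P [set t | generation (brw z) 1 t setT = 1] < 1)
  (theta : R) (theta_gt0 : (0 < theta)%R)
  (psi_fin : psi P (brw z) theta < +oo)
  (critical : psi P (brw z) 0 = 0)
  (Z1_L2 : \int[P]_t (generation (brw z) 1 t setT) ^+ 2 < +oo)
  (d' : measure_display) (T' : measurableType d') (P' : probability T' R)
  (X : nat -> {RV P' >-> (eseq R * nat)%type})
  (hX : forall k, size_biased P (brw z) theta (X k))
  (W : nat -> nat -> {RV P' >-> efield R})
  (hW : forall i k (A : set (efield R)), measurable A ->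
     distribution P' (W i k) A = pushforward P (brw z) A)
  (hXW : spine_independent X W) :
  P' [set t | Dinfty X W t setT = +oo] = 1.
Proof.
have Z1_fin : \int[P]_t (generation (brw z) 1 t setT) ^+ 2 \is a fin_num.
  rewrite ge0_fin_numE//; apply: integral_ge0 => t _.
  by rewrite expe2 mule_ge0// (generationE hz); apply: esum_ge0 => *; rewrite lee_fin.
have io := side_tree_io hz critical hZ1 psi_fin hX hW hXW
  (esym (fineK Z1_fin)).
(* The event that some spine increment is infinite, a countable union of null events. *)
set dead := \bigcup_k (X k @^-1` @marked_dead R).
have mX k : measurable (X k @^-1` @marked_dead R).
  by have := measurable_funPTI (X k) (@measurable_marked_dead R).
have mdead : measurable dead by exact: bigcupT_measurable.
have dead0 : P' dead = 0.
  apply/negligibleP => //; apply: negligible_bigcup => k.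
  by apply/negligibleP => //; exact: (marked_dead_null hz theta_gt0 hX k).
have mio : measurable (lim_sup_set (side_tree X W)).
  apply: bigcap_measurableType => n _; apply: bigcup_measurable => k _.
  exact: measurable_side_tree.
have mD := measurable_Dinfty_setT X W.
(* Up to the null event [dead], the event in question contains the limsup of the side trees, which
   has probability 1. *)
apply/eqP; rewrite eq_le probability_le1//= -io.
have -> : P' (lim_sup_set (side_tree X W)) =
    P' (lim_sup_set (side_tree X W) `\` dead).
  transitivity (P' (lim_sup_set (side_tree X W)) -
                P' (lim_sup_set (side_tree X W) `&` dead)); last first.
    by apply/esym/measureD => //; rewrite -ge0_fin_numE// fin_num_measure.
  suff -> : P' (lim_sup_set (side_tree X W) `&` dead) = 0 by rewrite sube0.
  by apply: subset_measure0 dead0 => //; exact: measurableI.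
apply: le_measure; rewrite ?inE//; first exact: measurableD.
move=> t [tio tdead] /=; apply: Dinfty_pinfty => // k kd.
by apply: tdead; exists k.
Qed.
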